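(* Assume $\int_0^1 t\,p(t)\,dt=+\infty$ and let $C\in\mathbb{R}$. Then the inequality boundary value problem $$-\Delta u+C|\nabla u|^2\ge p(d(x))g(u)\ \text{in }\Omega,\qquad u>0\ \text{in }\Omega,\qquad u=0\ \text{on }\partial\Omega$$ has no classical solution $u\in C^2(\Omega)\cap C(\overline{\Omega})$.
   Context: $\Omega\subset\mathbb{R}^N$ ($N\ge 2$) is a bounded domain with smooth boundary and $d(x)=\operatorname{dist}(x,\partial\Omega)$. The function $g\in C^1(0,\infty)$ is positive and decreasing with $\lim_{t\to0^+}g(t)=+\infty$. The function $p:(0,+\infty)\to(0,+\infty)$ is nonincreasing and Hölder continuous. *)

(* Defs.v *)
From HB Require Import structures.
From mathcomp Require Import all_boot all_order all_algebra.
From mathcomp Require Import all_classical all_reals all_analysis.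
Set Implicit Arguments. Unset Strict Implicit. Unset Printing Implicit Defensive.
Import Order.TTheory GRing.Theory Num.Theory.
Import numFieldNormedType.Exports.
Local Open Scope classical_set_scope.
Local Open Scope ring_scope.

Section Defs.
Variables (R : realType) (N : nat).
Notation V := 'rV[R]_N.

Definition ebase (i : 'I_N) : V := delta_mx 0 i.

Fixpoint dpart (l : seq 'I_N) (f : V -> R) : V -> R :=
  match l with
  | [::] => f
  | i :: l' => fun x => 'D_(ebase i) (dpart l' f) x
  end.

Definition enorm (x : V) : R := Num.sqrt (\sum_(i < N) x ord0 i ^+ 2).

Definition smooth (f : V -> R) : Prop :=
  forall l : seq 'I_N, continuous (dpart l f) /\
    forall (i : 'I_N) (x : V), derivable (dpart l f) x (ebase i).

Definition bounded_domain (O : set V) : Prop :=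
  O !=set0 /\ open O /\ connected O /\ exists M : R, forall x, O x -> enorm x <= M.

Definition bdry (O : set V) : set V := closure O `\` interior O.

Definition smooth_boundary (O : set V) : Prop :=
  exists rho : V -> R, smooth rho /\ O = [set x | rho x < 0] /\
    forall x, rho x = 0 -> exists i : 'I_N, dpart [:: i] rho x != 0.

Definition dist_bdry (O : set V) (x : V) : R :=
  inf [set enorm (x - y) | y in bdry O].

Definition C2_on (O : set V) (u : V -> R) : Prop :=
  forall x, O x ->
    (forall l : seq 'I_N, (size l <= 2)%N -> {for x, continuous (dpart l u)}) /\
    (forall l : seq 'I_N, (size l <= 1)%N ->
       forall i : 'I_N, derivable (dpart l u) x (ebase i)).

Definition laplacian (u : V -> R) (x : V) : R := \sum_(i < N) dpart [:: i; i] u x.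
Definition grad_norm2 (u : V -> R) (x : V) : R := \sum_(i < N) (dpart [:: i] u x) ^+ 2.

End Defs.

Definition loc_holder_pos (R : realType) (p : R -> R) : Prop :=
  forall a b : R, 0 < a -> a <= b ->
    exists alpha : R, exists L : R, 0 < alpha /\ alpha <= 1 /\
      forall s t, a <= s <= b -> a <= t <= b ->
        `|p s - p t| <= L * (`|s - t| `^ alpha).

(* Main.v *)
(** The singularity of [g] plays no role: [u] is bounded above, so [g u] is
    bounded below. Increasing [C] to [D > 0], the function
    [1 - exp (- D u)] lies in [0, 1] and has [- Laplacian >= k p(d)], [k > 0].
    For a multiple [s = - K rho] of the defining function, [d <= s] on the domain.
    Comparing with [Psi s], where [Psi'' = - p] and [Psi] vanishes at [e > 0],
    bounds [Psi (s x0)] independently of [e]; but [Psi (s x0)] grows at least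
    like the integral of [t p(t)] over [2 e, s x0], which diverges as [e -> 0].
    The comparison works because [p] is nonincreasing: if [Psi' a = 0] for some
    [a > max s] then [0 <= Psi' <= a p], so the Laplacian of [Psi s] is
    controlled by [p s <= p d] in spite of its first-order term. *)

Require Import Defs.
From HB Require Import structures.
From mathcomp Require Import all_boot all_order all_algebra.
From mathcomp Require Import all_classical all_reals all_analysis.
From mathcomp Require Import measurable_realfun ring lra.
Set Implicit Arguments.
Unset Strict Implicit.
Unset Printing Implicit Defensive.
Import Order.TTheory GRing.Theory Num.Theory.
Import numFieldNormedType.Exports.
Local Open Scope classical_set_scope.
Local Open Scope ring_scope.

(** * One-variable calculus: mean values, and continuity from a Hölder bound *)

Lemma mean_value_closed (R : realType) (f df : R -> R) (a b : R) :
  a <= b -> (forall x, a <= x <= b -> is_derive x 1 f (df x)) ->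
  exists2 c, a <= c <= b & f b - f a = df c * (b - a).
Proof.
move=> ab fdf; have [x||c] := @MVT_segment R f df a b ab.
- by rewrite in_itv/= => /andP[ax xb]; apply: fdf; rewrite !ltW.
- apply: derivable_within_continuous => x; rewrite in_itv/= => axb.
  by have [] := fdf _ axb.
- by rewrite in_itv/=; exists c.
Qed.

Lemma derive_ge0_le (R : realType) (f df : R -> R) (a b : R) :
  a <= b -> (forall x, a <= x <= b -> is_derive x 1 f (df x)) ->
  (forall x, a <= x <= b -> 0 <= df x) -> f a <= f b.
Proof.
move=> ab fdf df0; have [c acb fE] := mean_value_closed ab fdf.
by rewrite -subr_ge0 fE mulr_ge0 ?df0 ?subr_ge0.
Qed.

Lemma loc_holder_pos_continuous (R : realType) (p : R -> R) (t : R) :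
  loc_holder_pos p -> 0 < t -> {for t, continuous p}.
Proof.
move=> ph t0; have t2 : t / 2 < t by lra.
have [||alpha [L [a0 [_ holder]]]] := ph (t / 2) (t * 2); [lra|lra|].
(* On the punctured neighbourhood [|t - s|] is positive, so it tends to 0 from the right, as
   [powR_cvg0] requires. *)
have pow0 : (`|t - s| `^ alpha) @[s --> t^'] --> (0:R).
  apply: (@cvg_comp _ _ _ (fun s => `|t - s|) (fun x => x `^ alpha) _ (0:R)^'+);
    last exact: powR_cvg0.
  move=> A [e /= e0 eA]; exists e => //= s /= ts st; apply: eA => /=.
    by rewrite sub0r normrN normr_id.
  by rewrite normr_gt0 subr_eq0 eq_sym.
apply/continuous_withinNx/(@squeeze_cvgr _ _ _ _
  (fun s => p t - L * `|t - s| `^ alpha) (fun s => p t + L * `|t - s| `^ alpha)).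
- near=> s.
  suff : `|p t - p s| <= L * `|t - s| `^ alpha.
    by rewrite ler_norml => /andP[h1 h2]; apply/andP; split; lra.
  apply: holder; first by apply/andP; split; lra.
  apply/andP; split; apply: ltW; near: s; apply: nbhs_dnbhs.
    exact: lt_nbhsr.
  by apply: lt_nbhsl; lra.
- rewrite -[X in _ --> X]subr0 -[X in _ --> _ - X](mulr0 L).
  by apply: cvgB; [exact: cvg_cst|apply: cvgM => //; exact: cvg_cst].
- rewrite -[X in _ --> X]addr0 -[X in _ --> _ + X](mulr0 L).
  by apply: cvgD; [exact: cvg_cst|apply: cvgM => //; exact: cvg_cst].
Unshelve. all: by end_near. Qed.

(** * Integrals of functions continuous on the open half-line *)

Section positive_axis.
Context {R : realType} (q : R -> R).
Hypothesis q_cont : forall t : R, 0 < t -> {for t, continuous q}.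
Notation mu := (@lebesgue_measure R).

Lemma integrable_segment (b r : R) :
  0 < b -> mu.-integrable `[b, r] (EFin \o q).
Proof.
move=> b0; apply: continuous_compact_integrable; first exact: segment_compact.
apply: continuous_in_subspaceT => x; rewrite inE/= in_itv/= => /andP[bx _].
by apply: q_cont; exact: lt_le_trans bx.
Qed.

Lemma is_derive_primitive (b r : R) : 0 < b -> b < r ->
  is_derive r 1 (fun x => \int[mu]_(t in `[b, x]) q t) (q r).
Proof.
(* Integrability up to [r + 1] makes [r] an interior point, where the derivative is two-sided. *)
move=> b0 br; have r1 : r < r + 1 by lra.
have [d1 d2] := continuous_FTC1_closed r1 (integrable_segment (r + 1) b0) br
  (q_cont (lt_trans b0 br)).
by rewrite -d2 derive1E; exact: derivableP.
Qed.

(** If every truncation stayed below [M], monotone convergence would bound the integral over []0,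
    r]] by [M]; the integral over a segment away from 0 is finite, so the one over []0, 1]] would be
    finite too. *)
Lemma divergent_integral_truncation (r M : R) :
  (forall t : R, 0 < t -> 0 <= q t) ->
  (\int[mu]_(t in `]0%R, 1%R]) (q t)%:E = +oo)%E -> 0 < r ->
  exists b, [/\ 0 < b, b < r & M <= \int[mu]_(t in `[b, r]) q t].
Proof.
move=> q0 qoo r0; apply: contrapT => /forallNP small.
have mq (A : set (measurableTypeR R)) : measurable A ->
    A `<=` [set t : R | 0 < t] -> measurable_fun A (fun t => (q t)%:E).
  move=> mA A0; apply/measurable_EFinP.
  have : measurable_fun [set t : R | 0 < t] q.
    apply: open_continuous_measurable_fun; first exact: open_gt.
    by move=> x; rewrite inE/= => x0; exact: q_cont.
  by apply: measurable_funS => //; apply: open_measurable; exact: open_gt.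
(* Starting the denominators at 2 keeps the left end strictly below [r], as the negated claim
   demands. *)
pose E n : set (measurableTypeR R) := `[r / n.+2%:R, r]%classic.
have E0 n t : E n t -> 0 < t.
  by rewrite /E/= in_itv/= => /andP[+ _]; apply: lt_le_trans; rewrite divr_gt0.
have mE n : measurable (E n) by exact: measurable_itv.
have UE : \bigcup_n E n = `]0, r]%classic.
  apply/seteqP; split => [t [n _ Et]|t]/=.
    by rewrite in_itv/= (E0 n)//; move: Et; rewrite /E/= in_itv/= => /andP[].
  rewrite in_itv/= => /andP[t0 tr].
  exists (Num.truncn (r / t)) => //; rewrite /E/= in_itv/= tr andbT.
  rewrite ler_pdivrMr// mulrC -ler_pdivrMr// ltW//.
  apply: lt_trans (truncnS_gt _) _.
  by rewrite ltr_nat.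
have intE n : (\int[mu]_(t in E n) (q t)%:E <= M%:E)%E.
  have rn0 : 0 < r / n.+2%:R by rewrite divr_gt0.
  have rnr : r / n.+2%:R < r.
    by rewrite ltr_pdivrMr// ltr_pMr// ltr1n.
  rewrite -(@fineK _ (\int[mu]_(t in E n) _))%E; last first.
    by apply: integrable_fin_num => //; exact: integrable_segment.
  rewrite lee_fin leNgt; apply/negP => Mlt.
  by apply: (small (r / n.+2%:R)); split => //; exact: ltW.
have intr : (\int[mu]_(t in `]0%R, r]) (q t)%:E <= M%:E)%E.
  rewrite -UE; have cv : (\int[mu]_(t in E n) (q t)%:E @[n --> \oo] -->
      \int[mu]_(t in \bigcup_n E n) (q t)%:E)%E.
    apply: ge0_nondecreasing_set_cvg_integral => //.
    - apply/nondecreasing_seqP => n; rewrite subsetEset => t.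
      rewrite /E/= !in_itv/= => /andP[h ->]; rewrite andbT; apply: le_trans h.
      by rewrite ler_pM2l// lef_pV2 ?posrE ?ler_nat.
    - by move=> n; apply: mq => // t /E0.
    - by move=> n t /E0 t0; rewrite lee_fin q0.
  have <- := cvg_lim (@ereal_hausdorff R) cv.
  apply: lime_le; first by apply/cvg_ex; eexists; exact: cv.
  by apply: nearW.
have : (\int[mu]_(t in `]0%R, 1%R]) (q t)%:E < +oo)%E; last by rewrite qoo ltxx.
(* Enlarging to []0, s]] treats [r < 1] and [1 <= r] at once. *)
pose s := Num.max 1 r.
have s0 : 0 < s by rewrite lt_max r0 orbT.
have rs : r <= s by rewrite le_max lexx orbT.
apply: (@le_lt_trans _ _ (\int[mu]_(t in `]0%R, s]) (q t)%:E)%E).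
  apply: ge0_subset_integral => //.
  - by apply: mq => // t; rewrite /= in_itv/= => /andP[].
  - by move=> t; rewrite /= in_itv/= => /andP[t0 _]; rewrite lee_fin q0.
  - by apply: subset_itvl; rewrite bnd_simp le_max lexx.
rewrite (@itv_bndbnd_setU _ _ _ (BRight r)) ?bnd_simp ?(ltW r0)//.
have sub t : (`]0, r] `|` `]r, s])%classic t -> 0 < t.
  by case; rewrite /= in_itv/= => /andP[] // + _; exact: lt_trans.
rewrite ge0_integral_setU//=; last 3 first.
- by apply: mq => //; exact: measurableU.
- by move=> t /sub t0; rewrite lee_fin q0.
- by apply/disj_setPS => t /= []; rewrite !in_itv/= => /andP[_ +] /andP[+ _]; lra.
apply: lte_add_pinfty; first exact: le_lt_trans intr (ltry _).
apply: le_lt_trans (integrable_lty _ (integrable_segment s r0)) => //.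
apply: ge0_subset_integral => //.
- by apply: mq => // t; rewrite /= in_itv/= => /andP[+ _]; exact: lt_le_trans.
- move=> t; rewrite /= in_itv/= => /andP[+ _] => rt.
  by rewrite lee_fin q0//; exact: lt_le_trans rt.
- by apply: subset_itvr; rewrite bnd_simp.
Qed.

End positive_axis.

(** * The one-dimensional barrier *)

(** Take for [psi r] the integral of [p] over [[r, a]] and for [Psi] its primitive vanishing at [e].
    By parts, [Psi r0] is at least the integral of [(t - e) * p t] over [[e, r0]], which divergence
    makes as large as desired for small [e]. *)
Lemma barrier_exists (R : realType) (p : R -> R) (r0 a M : R) :
  (forall t : R, 0 < t -> {for t, continuous p}) ->
  (forall t : R, 0 < t -> 0 < p t) ->
  (forall s t : R, 0 < s -> s <= t -> p t <= p s) ->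
  (\int[@lebesgue_measure R]_(t in `]0%R, 1%R]) (t * p t)%:E = +oo)%E ->
  0 < r0 -> r0 < a ->
  exists (e : R) (Psi psi : R -> R),
    [/\ 0 < e, e < r0, Psi e = 0, M <= Psi r0 &
      forall r, e <= r <= a ->
        [/\ is_derive r 1 Psi (psi r), is_derive r 1 psi (- p r),
            0 <= psi r & psi r <= a * p r]].
Proof.
move=> p_cont p0 p_ninc poo r0_gt0 r0a.
pose q t := t * p t.
have q_cont (t : R) : 0 < t -> {for t, continuous q}.
  by move=> t0; apply: continuousM; [exact: cvg_id|exact: p_cont].
have q0 (t : R) : 0 < t -> 0 <= q t by move=> t0; rewrite mulr_ge0 ?ltW ?p0.
have [b [b0 br0 bM]] := divergent_integral_truncation q_cont (2 * M) q0 poo r0_gt0.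
(* With [b = 2 * e], [t - e] is at least [t / 2] beyond [b], whence the bound [2 * M] above.
   Primitives start at [c], below [e], so that they are differentiable at [e] itself. *)
pose e := b / 2; pose c := b / 4.
have c0 : 0 < c by rewrite /c; lra.
have ce : c < e by rewrite /c/e; lra.
have e0 : 0 < e by rewrite /e; lra.
have eb : e < b by rewrite /e; lra.
have [F dF] : exists F, forall r : R, e <= r -> is_derive r 1 F (p r).
  exists (fun x => \int[@lebesgue_measure R]_(t in `[c, x]) p t) => r er.
  by apply: is_derive_primitive => //; exact: lt_le_trans er.
have [G dG GB] : exists2 G, forall r : R, e <= r -> is_derive r 1 G (q r) &
    G r0 - G b = \int[@lebesgue_measure R]_(t in `[b, r0]) q t.
  exists (fun x => \int[@lebesgue_measure R]_(t in `[c, x]) q t) => [r er|].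
    by apply: is_derive_primitive => //; exact: lt_le_trans er.
  rewrite (@Rintegral_itvB _ q (BLeft c) (BRight r0) b); last 3 first.
  - exact: integrable_segment.
  - by rewrite bnd_simp; lra.
  - by rewrite bnd_simp ltW.
  apply: Rintegral_itv_obnd_cbnd.
  apply: integrableS (integrable_segment q_cont r0 b0) => //.
  by apply: subset_itvr; rewrite bnd_simp.
move: bM; rewrite -GB => {GB} bM.
pose psi r := F a - F r.
(* Integrating [psi] by parts gives a formula whose terms differentiate one by one. *)
pose Psi r := (r - e) * psi r + (G r - G e) - e * (F r - F e).
have F_le s t : e <= s -> s <= t -> F s <= F t.
  move=> es st; apply: (@derive_ge0_le _ F p) => // x /andP[sx _].
    by apply: dF; lra.
  by apply/ltW/p0; lra.
exists e, Psi, psi; split.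
- exact: e0.
- exact: lt_trans br0.
- by rewrite /Psi !subrr mul0r mulr0; ring.
- suff : 2 * M <= 2 * (G r0 - e * F r0 - (G e - e * F e)).
    have : 0 <= (r0 - e) * psi r0.
      by rewrite mulr_ge0 ?subr_ge0 ?F_le//; lra.
    by rewrite /Psi; lra.
  have dH (k r : R) : e <= r ->
      is_derive r 1 (fun x => G x - k * F x) (q r - k * p r).
    move=> er; have dFr := dF _ er; have dGr := dG _ er.
    by apply: is_derive_eq.
  (* [H1] drops the integral of [(t - e) * p t] over [[e, b]]; [H2] is the integrated form of
     [t - e >= t / 2] on [[b, r0]]. *)
  have H1 : G e - e * F e <= G b - e * F b.
    apply: (@derive_ge0_le _ (fun x => G x - e * F x) _ _ _ (ltW eb)
      (fun x ex => dH e x (proj1 (andP ex)))) => x /andP[ex _].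
    by rewrite /q -mulrBl mulr_ge0 ?subr_ge0// ltW// p0//; lra.
  have H2 : G b - 2 * e * F b <= G r0 - 2 * e * F r0.
    apply: (@derive_ge0_le _ (fun x => G x - 2 * e * F x) _ _ _ (ltW br0)
      (fun x bx => dH (2 * e) x (le_trans (ltW eb) (proj1 (andP bx))))).
    move=> x /andP[bx _]; rewrite /q -mulrBl mulr_ge0//; first by rewrite /e; lra.
    by rewrite ltW// p0//; lra.
  by move: bM H1 H2; lra.
- move=> r /andP[er ra]; have dFr := dF _ er; have dGr := dG _ er.
  have dpsi : is_derive r 1 psi (- p r).
    by apply: is_derive_eq; rewrite /=; ring.
  split; [|exact: dpsi|..].
  + apply: is_derive_eq.
    rewrite /GRing.scale/= /q; ring.
  + by rewrite subr_ge0 F_le.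
  (* Here [psi r = p x * (a - r)] for some [x >= r], and monotonicity replaces [p x] by [p r]. *)
  + have [|x /andP[rx xa] FE] := @mean_value_closed R F p r a ra.
      by move=> x /andP[rx _]; apply: dF; lra.
    have r_gt0 : 0 < r by lra.
    rewrite /psi FE [leRHS]mulrC ler_pM ?subr_ge0//.
    * by apply/ltW/p0; lra.
    * exact: p_ninc.
    * by lra.
Qed.

(** * Second-order test at a maximum, along a line *)

(** The derivative vanishes at 0; were [D] positive, it would be positive just to the right of 0,
    and the mean value theorem would give [f t > f 0] there. *)
Lemma second_derivative_at_max (R : realType) (f df : R -> R) (D : R) :
  (\forall t \near (0 : R), is_derive (t : R) 1 f (df t)) ->
  is_derive (0 : R) 1 df D ->
  (\forall t \near (0 : R), f t <= f 0) -> D <= 0.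
Proof.
move=> f_df [ddf dfD] fmax; rewrite leNgt; apply/negP => D0.
have [e /= e0 eP] : \forall t \near (0 : R), is_derive (t : R) 1 f (df t) /\ f t <= f 0.
  by near=> t; split; near: t.
have {}eP (t : R) : -e < t < e -> is_derive t 1 f (df t) /\ f t <= f 0.
  by move=> te; apply: eP; rewrite /= sub0r normrN ltr_norml.
have df0 : df 0 = 0.
  have [] : is_derive (0 : R) 1 f 0.
    apply: (@derive1_at_max _ _ (-e) e); rewrite ?in_itv/=; [lra|..|lra|].
      by move=> t; rewrite in_itv => /eP[[]].
    by move=> t; rewrite in_itv => /eP[].
  by move=> _ d0; have [|[_ <-]] := eP 0; [lra|].
have : \forall h \near (0 : R)^', 0 < h^-1 *: (df (h *: 1 + 0) - df 0).
  suff dcv : (fun h => h^-1 *: (df (h *: 1 + 0) - df 0)) @ (0 : R)^' --> D.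
    exact: (cvgr_gt D).
  by move: ddf; rewrite /derivable => /cvg_ex[l lP]; rewrite -dfD /derive (cvg_lim _ lP).
move=> [e' /= e'0 e'P].
pose t := Num.min e e' / 2.
have [te te' t0] : [/\ t < e, t < e' & 0 < t].
  rewrite /t; split.
  - by rewrite (@le_lt_trans _ _ (e / 2)) ?ler_pM2r ?ge_min ?lexx//; lra.
  - by rewrite (@le_lt_trans _ _ (e' / 2)) ?ler_pM2r ?ge_min ?lexx ?orbT//; lra.
  - by rewrite divr_gt0// lt_min e0.
have [x||c] := @MVT _ f df 0 t t0.
- by rewrite in_itv/= => /andP[x0 xt]; have [] := eP x; [lra|].
- apply: derivable_within_continuous => x; rewrite in_itv/= => /andP[x0 xt].
  by have [|[]] := eP x; [lra|].
rewrite in_itv/= => /andP[c0 ct] fE.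
have dfc : 0 < df c.
  have : 0 < c^-1 *: (df (c *: 1 + 0) - df 0).
    apply: e'P; last exact: lt0r_neq0.
    by rewrite /= sub0r normrN gtr0_norm//; lra.
  by rewrite [c *: 1]mulr1 addr0 df0 subr0 pmulr_rgt0// invr_gt0.
have [|_] := eP t; first lra.
by rewrite -subr_le0 fE subr0 leNgt mulr_gt0.
Unshelve. all: by end_near. Qed.

(** The two difference quotients are the same function of [h]. *)
Lemma is_derive_line (R : realType) (V : normedModType R) (f : V -> R)
    (x v : V) (t df : R) :
  is_derive (x + t *: v) v f df -> is_derive t 1 (fun s => f (x + s *: v)) df.
Proof.
have E : (fun h => h^-1 *: (f (x + (h *: 1 + t) *: v) - f (x + t *: v))) =
         (fun h => h^-1 *: (f (h *: v + (x + t *: v)) - f (x + t *: v))).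
  apply/funext => h; congr (_ *: (f _ - _)).
  by rewrite [h *: 1]mulr1 scalerDl addrCA.
by case=> d1 d2; split; rewrite /derivable /derive/= ?E.
Qed.

(** The left side is the second derivative at 0 of the maximised function. The exponential turns
    [u2] into [u2 - C * u1 0 ^+ 2], one coordinate's share of the differential operator. *)
Lemma composed_second_derivative_at_max (R : realType)
    (Psi psi s s1 u u1 : R -> R) (s2 u2 q c C : R) :
  (\forall t \near (0 : R), is_derive (t : R) 1 s (s1 t)) ->
  is_derive (0 : R) 1 s1 s2 ->
  (\forall t \near (0 : R), is_derive (t : R) 1 u (u1 t)) ->
  is_derive (0 : R) 1 u1 u2 ->
  (\forall r \near s 0, is_derive (r : R) 1 Psi (psi r)) ->
  is_derive (s 0) 1 psi (- q) ->
  (\forall t \near (0 : R), Psi (s t) + c * expR (- (C * u t)) <=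
                            Psi (s 0) + c * expR (- (C * u 0))) ->
  psi (s 0) * s2 - q * s1 0 ^+ 2
    - c * C * expR (- (C * u 0)) * (u2 - C * u1 0 ^+ 2) <= 0.
Proof.
move=> ds ds1 du du1 dPsi dpsi fmax.
apply: (@second_derivative_at_max _
  (fun t => Psi (s t) + c * expR (- (C * u t)))
  (fun t => psi (s t) * s1 t - c * C * (expR (- (C * u t)) * u1 t))) => //.
  have s_cont : {for 0, continuous s}.
    have [d _] := nbhs_singleton ds.
    by apply: differentiable_continuous; exact/derivable1_diffP.
  have := s_cont _ dPsi.
  rewrite nbhs_filterE => nearPsi; near=> t.
  have ? : is_derive t 1 s (s1 t) by near: t.
  have ? : is_derive t 1 u (u1 t) by near: t.
  have ? : is_derive (s t) 1 Psi (psi (s t)) by near: t.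
  have ? : is_derive t 1 (fun x => Psi (s x)) (psi (s t) * s1 t).
    exact: is_derive1_comp.
  have ? : is_derive t 1 (fun x => - (C * u x)) (- (C * u1 t)).
    by apply: is_derive_eq; rewrite /GRing.scale/=; ring.
  have ? : is_derive t 1 (fun x => expR (- (C * u x)))
      (expR (- (C * u t)) * (- (C * u1 t))).
    exact: is_derive1_comp.
  by apply: is_derive_eq; rewrite /GRing.scale/=; ring.
have ds0 := nbhs_singleton ds; have du0 := nbhs_singleton du.
have dps : is_derive (0 : R) 1 (fun x => psi (s x)) (- q * s1 0).
  exact: is_derive1_comp.
have dCu : is_derive (0 : R) 1 (fun x => - (C * u x)) (- (C * u1 0)).
  by apply: is_derive_eq; rewrite /GRing.scale/=; ring.
have dexp : is_derive (0 : R) 1 (fun x => expR (- (C * u x)))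
    (expR (- (C * u 0)) * (- (C * u1 0))).
  exact: is_derive1_comp.
by apply: is_derive_eq; rewrite /GRing.scale/=; ring.
Unshelve. all: by end_near. Qed.

(** * Euclidean norm against the sup norm, which carries the topology *)

Section euclidean_norm.
Context {R : realType} {N : nat}.
Implicit Type x : 'rV[R]_N.

Lemma enorm_ge0 x : 0 <= enorm x. Proof. exact: sqrtr_ge0. Qed.

Lemma norm_le_enorm x : `|x| <= enorm x.
Proof.
rewrite /Num.norm/= mx_normrE; apply: bigmax_le => [|[i j] _]; first exact: enorm_ge0.
rewrite ord1 -sqrtr_sqr ler_wsqrtr// (bigD1 j)//= lerDl.
by apply: sumr_ge0 => k _; exact: sqr_ge0.
Qed.

Lemma coord_le_norm x i : `|x ord0 i| <= `|x|.
Proof.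
rewrite [leRHS]/Num.norm/= mx_normrE.
by apply/bigmax_geP; right => /=; exists (ord0, i).
Qed.

Lemma enorm_le_norm x : enorm x <= N%:R * `|x|.
Proof.
rewrite -[leRHS]ger0_norm ?mulr_ge0// -sqrtr_sqr ler_wsqrtr//.
apply: (@le_trans _ _ (\sum_(i < N) `|x| ^+ 2)).
  apply: ler_sum => i _; rewrite -real_normK ?num_real//.
  by rewrite ler_pXn2r ?nnegrE// coord_le_norm.
rewrite sumr_const card_ord -[leLHS]mulr_natl exprMn ler_wpM2r ?sqr_ge0//.
by rewrite -natrX ler_nat; case: (N) => // m; rewrite expnS expn1 leq_pmull.
Qed.

Lemma enorm_scale_ebase (t : R) (i : 'I_N) : enorm (t *: ebase R i) = `|t|.
Proof.
rewrite /enorm (bigD1 i)//= big1 ?addr0; last first.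
  by move=> j ji; rewrite !mxE (negbTE ji) andbF mulr0 expr0n.
by rewrite !mxE !eqxx mulr1 sqrtr_sqr.
Qed.

Lemma norm_ebase (i : 'I_N) : `|ebase R i| <= 1.
Proof.
apply: le_trans (norm_le_enorm _) _.
by rewrite -[ebase R i]scale1r enorm_scale_ebase normr1.
Qed.

End euclidean_norm.

(** * Distance to the boundary *)

Section distance_to_boundary.
Context {R : realType} {N : nat}.
Variable O : set 'rV[R]_N.

Lemma dist_bdry_le (x y : 'rV[R]_N) : bdry O y -> dist_bdry O x <= enorm (x - y).
Proof.
move=> Oy; apply: ge_inf; last by exists y.
by exists 0 => _ [z _ <-]; exact: enorm_ge0.
Qed.

(** A sup-norm ball inside [O] contains no boundary point, and the Euclidean norm dominates the sup
    norm. A nonempty boundary is required because [inf] of the empty set is 0. *)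
Lemma dist_bdry_gt0 (x : 'rV[R]_N) :
  open O -> bdry O !=set0 -> O x -> 0 < dist_bdry O x.
Proof.
move=> oO [y0 By0] Ox.
have /nbhs_ballP[e /= e0 eO] : nbhs x O by exact: open_nbhs_nbhs.
apply: (@lt_le_trans _ _ e) => //; apply: lb_le_inf; first by exists (enorm (x - y0)), y0.
move=> _ [y [_ nOy] <-]; apply: le_trans (norm_le_enorm _).
rewrite leNgt; apply/negP => xy; apply: nOy.
rewrite (interior_id _).1//; apply: eO.
by rewrite -ball_normE.
Qed.

End distance_to_boundary.

(** * Geometry of a regular sublevel set *)

Section defining_function.
Context {R : realType} {N : nat}.
Variable rho : 'rV[R]_N -> R.
Hypothesis rho_smooth : smooth rho.
Notation Omega := [set x | rho x < 0].
Hypothesis rho_regular :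
  forall x, rho x = 0 -> exists i : 'I_N, dpart [:: i] rho x != 0.

Lemma smooth_continuous : continuous rho.
Proof. by have [] := rho_smooth [::]. Qed.

Lemma smooth_is_derive_line (l : seq 'I_N) (i : 'I_N) (x : 'rV[R]_N) (t : R) :
  is_derive t 1 (fun s => dpart l rho (x + s *: ebase R i))
    (dpart (i :: l) rho (x + t *: ebase R i)).
Proof.
apply: is_derive_line; apply: derivableP.
by have [_] := rho_smooth l; exact.
Qed.

Lemma continuous_line (T : topologicalType) (f : 'rV[R]_N -> T) (x v : 'rV[R]_N) :
  continuous f -> continuous (fun s : R => f (x + s *: v)).
Proof.
move=> fc s.
apply: (@cvg_comp _ _ _ (fun s : R => x + s *: v) f _ (nbhs (x + s *: v)));
  last exact: fc.
by apply: cvgD; [exact: cvg_cst|exact: scalel_continuous].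
Qed.

Lemma closure_sublevel (x : 'rV[R]_N) : closure Omega x -> rho x <= 0.
Proof.
move=> cOx; have : closed [set x | rho x <= 0].
  apply: (@closed_comp _ _ rho [set x | x <= 0]); last exact: closed_le.
  by move=> y _; exact: smooth_continuous.
move=> /closure_id E; suff : closure [set x | rho x <= 0] x by rewrite -E.
by apply: closure_subset cOx => y /ltW.
Qed.

(** Outside the closure, [rho] would be nonnegative near [y], so [y] would be a local minimum and
    every partial derivative would vanish there. *)
Lemma bdry_sublevel (y : 'rV[R]_N) : rho y = 0 -> bdry Omega y.
Proof.
move=> rhoy; split; last first.
  by move/interior_subset; rewrite /= rhoy ltxx.
apply: contrapT => nCl.
have : \forall x \near y, 0 <= rho x.
  move/existsNP : nCl => [B /not_implyP[By OB]].
  near=> x; rewrite leNgt; apply/negP => rx; apply: OB.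
  by exists x; split => //; near: x.
have [i /eqP Di] := rho_regular rhoy; move=> near0; apply: Di.
pose h s := rho (y + s *: ebase R i).
have /nbhs_ballP[e /= e0 eh] : \forall s \near (0 : R), 0 <= h s.
  have yE : y + 0 *: ebase R i = y by rewrite scale0r addr0.
  have := @continuous_line _ id y (ebase R i) (fun=> cvg_id) 0.
  by rewrite /continuous_at yE => /(_ _ near0).
have dh (t : R) : is_derive t 1 h (dpart [:: i] rho (y + t *: ebase R i)).
  exact: (smooth_is_derive_line [::]).
have h0 : h 0 = 0 by rewrite /h scale0r addr0.
have [] : is_derive (0 : R) 1 h 0.
  apply: (@derive1_at_min _ _ (- e) e); [lra|by move=> t _; have [] := dh t|..].
    by rewrite in_itv/=; lra.
  move=> t; rewrite in_itv/= h0 => te; apply: eh.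
  by rewrite -ball_normE/= sub0r normrN ltr_norml.
by move=> _ d0; have [_] := dh 0; rewrite d0 scale0r addr0.
Unshelve. all: by end_near. Qed.

Hypothesis Omega_neq0 : Omega !=set0.
Variable M : R.
Hypothesis Omega_bounded : forall x, rho x < 0 -> enorm x <= M.

Lemma compact_closed_subset (A : set 'rV[R]_N) :
  closed A -> A `<=` closure Omega -> compact A.
Proof.
move=> cA AO; apply: bounded_closed_compact => //.
exists M; split; first exact: num_real.
move=> m Mm x /AO clx; apply: le_trans (ltW Mm).
have clM : closed [set x : 'rV[R]_N | `|x| <= M].
  apply: (@closed_comp _ _ (fun x : 'rV[R]_N => `|x|) [set x | x <= M]); last exact: closed_le.
  by move=> y _; exact: norm_continuous.
suff : closure [set x : 'rV[R]_N | `|x| <= M] x by rewrite -((closure_id _).1 clM).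
apply: closure_subset clx => y /Omega_bounded; apply: le_trans.
exact: norm_le_enorm.
Qed.

(** A ray from [x0] leaves the bounded set, so [rho] vanishes somewhere on it. The length [T] puts
    the end point at norm at least [|M| + 1]. *)
Lemma bdry_sublevel_neq0 : (0 < N)%N -> bdry Omega !=set0.
Proof.
move=> N0; have [x0 Ox0] := Omega_neq0.
pose i0 := Ordinal N0; pose T := `|M| + enorm x0 + 1.
have T0 : 0 <= T by rewrite !addr_ge0 ?enorm_ge0.
have rhoT : 0 <= rho (x0 + T *: ebase R i0).
  rewrite leNgt; apply/negP => /Omega_bounded/(le_trans (norm_le_enorm _)).
  apply/negP; rewrite -ltNge.
  have : `|T *: ebase R i0| <= `|x0 + T *: ebase R i0| + `|x0|.
    by rewrite -{1}(addKr x0 (T *: ebase R i0)) addrC (le_trans (ler_normB _ _)).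
  have : T <= `|T *: ebase R i0|.
    apply: le_trans (coord_le_norm _ i0).
    by rewrite !mxE !eqxx mulr1 ler_norm.
  have := norm_le_enorm x0; have := ler_norm M; rewrite /T; lra.
have [||t _ rt] := @IVT R (fun s => rho (x0 + s *: ebase R i0)) 0 T 0 T0.
- by apply: continuous_subspaceT; apply: continuous_line; exact: smooth_continuous.
- by rewrite scale0r addr0 ge_min le_max (ltW Ox0) rhoT orbT.
by exists (x0 + t *: ebase R i0); exact: bdry_sublevel.
Qed.

(** Near [z] some signed coordinate direction raises [rho] at a rate above [c], half the size of the
    partial derivative at [z]. Moving from [x] by [- rho x / c] in that direction must meet the zero
    set. *)
Lemma dist_bdry_le_level_near_bdry (z : 'rV[R]_N) : rho z = 0 ->
  exists c : R, 0 < c /\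
    \forall x \near z, rho x < 0 -> dist_bdry Omega x <= c * (- rho x).
Proof.
move=> rhoz; have [i Di] := rho_regular rhoz.
set D := dpart _ _ _ in Di; pose eta := Num.sg D.
have eta1 : `|eta| = 1 by rewrite normr_sg Di.
pose c := `|D| / 2; have c0 : 0 < c by rewrite divr_gt0// normr_gt0.
exists c^-1; split; first by rewrite invr_gt0.
have : \forall x \near z, c < dpart [:: i] rho x * eta.
  have : (fun x => dpart [:: i] rho x * eta) @ z --> D * eta.
    have [rho1_cont _] := rho_smooth [:: i].
    by apply: (@cvgM _ _ (nbhs z)); [exact: rho1_cont|exact: cvg_cst].
  move=> /cvgr_gt; apply; rewrite mulrC -normrEsg /c.
  by have : 0 < `|D|; [rewrite normr_gt0|lra].
move=> /nbhs_ballP[d /= d0 dP].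
(* This makes [T < d / 2], so the path from [x] stays in the ball of radius [d] where the slope
   bound holds. *)
have rho_small : \forall x \near z, - (c * d / 2) < rho x.
  apply: (@cvgr_gt _ _ (nbhs z) _ rho (rho z)); first exact: smooth_continuous.
  by rewrite rhoz oppr_lt0 divr_gt0// mulr_gt0.
near=> x => rx.
have xz : `|z - x| < d / 2.
  by near: x; apply/nbhs_ballP; exists (d / 2); rewrite /= ?divr_gt0// -ball_normE.
have rxd : - (c * d / 2) < rho x by near: x.
pose h s := rho (x + (s * eta) *: ebase R i).
pose T := - rho x / c.
have T0 : 0 < T by rewrite divr_gt0// oppr_gt0.
have Td : T < d / 2 by rewrite /T ltr_pdivrMr//; lra.
have dh (t : R) : is_derive t 1 h (dpart [:: i] rho (x + (t * eta) *: ebase R i) * eta).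
  apply: (@is_derive1_comp _ (fun s => rho (x + s *: ebase R i)) (fun t => t * eta)).
    exact: (smooth_is_derive_line [::]).
  by apply: is_derive_eq; rewrite /GRing.scale/=; ring.
have h0 : h 0 = rho x by rewrite /h mul0r scale0r addr0.
have hT : 0 <= h T.
  have [t /andP[t0 tT] hE] := mean_value_closed (ltW T0) (fun t _ => dh t).
  have : c < dpart [:: i] rho (x + (t * eta) *: ebase R i) * eta.
    apply: dP; rewrite -ball_normE/= opprD addrA.
    apply: le_lt_trans (ler_normB _ _) _.
    rewrite (splitr d) ltr_leD//.
    rewrite normrZ normrM eta1 mulr1 (ger0_norm t0).
    apply: le_trans (_ : t * 1 <= _); first by rewrite ler_wpM2l// norm_ebase.
    by rewrite mulr1; lra.
  move=> /ltW; rewrite -(ler_pM2r T0); move: hE; rewrite h0 subr0 => <-.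
  by rewrite /T mulrC divfK ?gt_eqF//; lra.
have [||t] := @IVT R h 0 T 0 (ltW T0).
- apply: derivable_within_continuous => t _.
  by have [] := dh t.
- by rewrite h0 ge_min le_max (ltW rx) hT orbT.
rewrite in_itv/= => /andP[t0 tT] ht.
apply: le_trans (dist_bdry_le _ (bdry_sublevel ht)) _.
rewrite opprD addNKr -scaleNr enorm_scale_ebase normrN normrM eta1 mulr1 ger0_norm//.
by rewrite mulrC.
Unshelve. all: by end_near. Qed.

(** Near a boundary point the previous bound applies; near an interior point the distance is bounded
    and [- rho] is bounded below. Compactness of the closure merges the local constants. *)
Lemma dist_bdry_le_level : (0 < N)%N ->
  exists K : R, 0 < K /\
    forall x, rho x < 0 -> dist_bdry Omega x <= K * (- rho x).
Proof.
move=> N0; have [y0 By0] := bdry_sublevel_neq0 N0.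
have clO : compact (closure Omega).
  by apply: compact_closed_subset => //; exact: closed_closure.
(* The estimate persists when [K] grows, so it can be stated for [K] near [+oo] and made uniform on
   the closure. *)
have := (compact_near_coveringP _).1 clO R (+oo%R)
  (fun K x => rho x < 0 -> dist_bdry Omega x <= K * (- rho x)) _.
have loc z : closure Omega z -> exists c : R, 0 < c /\
    \forall x \near z, rho x < 0 -> dist_bdry Omega x <= c * (- rho x).
  move=> /closure_sublevel; rewrite le_eqVlt => /orP[/eqP|rz].
    exact: dist_bdry_le_level_near_bdry.
  pose m := - rho z / 2; have m0 : 0 < m by rewrite divr_gt0// oppr_gt0.
  pose B := N%:R * (`|z - y0| + 1).
  have B0 : 0 < B by rewrite mulr_gt0 ?ltr0n// ltr_wpDl.
  exists (B / m); split; first by rewrite divr_gt0.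
  near=> x => rx.
  apply: le_trans (dist_bdry_le _ By0) _.
  apply: le_trans (enorm_le_norm _) _.
  have xz : `|z - x| < 1.
    by near: x; apply/nbhs_ballP; exists 1; rewrite //= -ball_normE.
  have rxm : rho x < - m.
    near: x; apply: (@cvgr_lt _ _ (nbhs z) _ rho (rho z)); first exact: smooth_continuous.
    by rewrite /m; lra.
  apply: (@le_trans _ _ B).
    rewrite ler_wpM2l// -(subrKA z) addrC (le_trans (ler_normD _ _))// lerD2l.
    by rewrite distrC ltW.
  rewrite -[leLHS](divfK (lt0r_neq0 m0)) ler_wpM2l//; last lra.
  by rewrite divr_ge0 ?ltW.
move=> /(_ _)[|K0 [_ K0P]].
  move=> z /loc[c [c0 cP]].
  exists ([set x | rho x < 0 -> dist_bdry Omega x <= c * (- rho x)],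
          [set K | c <= K]); first split => //.
    by apply: nbhs_pinfty_ge; exact: num_real.
  move=> [x K] [/= xP cK] rx; apply: le_trans (xP rx) _.
  by rewrite ler_wpM2r// oppr_ge0 ltW.
exists (Num.max (K0 + 1) 1); split; first by rewrite lt_max ltr01 orbT.
move=> x rx; apply: K0P => //; last exact: subset_closure.
by rewrite lt_max ltrDl ltr01.
Unshelve. all: by end_near. Qed.

End defining_function.

(** * The Laplacian at a maximum *)

Lemma C2_on_is_derive_line (R : realType) (N : nat) (O : set 'rV[R]_N)
    (u : 'rV[R]_N -> R) (l : seq 'I_N) (i : 'I_N) (x : 'rV[R]_N) (t : R) :
  C2_on O u -> O (x + t *: ebase R i) -> (size l <= 1)%N ->
  is_derive t 1 (fun s => dpart l u (x + s *: ebase R i))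
    (dpart (i :: l) u (x + t *: ebase R i)).
Proof.
move=> C2u Ox l1; apply: is_derive_line; apply: derivableP.
by have [_] := C2u _ Ox; exact.
Qed.

Lemma smooth_C2_on (R : realType) (N : nat) (O : set 'rV[R]_N)
    (u : 'rV[R]_N -> R) : smooth u -> C2_on O u.
Proof.
move=> su x _; split => l _; first by have [uc _] := su l; exact: uc.
by have [_ ud] := su l => i; exact: ud.
Qed.

(** The one-variable test on each coordinate line through [x] makes every summand nonpositive. *)
Lemma laplacian_at_max (R : realType) (N : nat) (O : set 'rV[R]_N)
    (rho u : 'rV[R]_N -> R) (Psi psi : R -> R) (x : 'rV[R]_N) (q c C K : R) :
  open O -> O x -> C2_on O rho -> C2_on O u ->
  (\forall r \near - (K * rho x), is_derive (r : R) 1 Psi (psi r)) ->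
  is_derive (- (K * rho x)) 1 psi (- q) ->
  (\forall y \near x, Psi (- (K * rho y)) + c * expR (- (C * u y)) <=
                      Psi (- (K * rho x)) + c * expR (- (C * u x))) ->
  psi (- (K * rho x)) * (- (K * laplacian rho x))
    - q * (K ^+ 2 * grad_norm2 rho x)
    - c * C * expR (- (C * u x)) * (laplacian u x - C * grad_norm2 u x) <= 0.
Proof.
move=> oO Ox C2rho C2u dPsi dpsi fmax.
rewrite /laplacian /grad_norm2 !mulr_sumr -sumrB -sumrN !mulr_sumr -!sumrB.
apply: sumr_le0 => i _.
pose l t := x + t *: ebase R i.
have l0 : l 0 = x by rewrite /l scale0r addr0.
have near_l (P : set 'rV[R]_N) : nbhs x P -> \forall t \near (0 : R), P (l t).
  move=> xP; have := @continuous_line _ _ _ id x (ebase R i) (fun=> cvg_id) 0.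
  by rewrite /continuous_at /= -/(l 0) l0 => /(_ _ xP).
have Ol : \forall t \near (0 : R), O (l t) by apply: near_l; exact: open_nbhs_nbhs.
have Ol0 : O (l 0) by rewrite l0.
have := @composed_second_derivative_at_max R Psi psi
  (fun t => - (K * rho (l t))) (fun t => - (K * dpart [:: i] rho (l t)))
  (u \o l) (dpart [:: i] u \o l)
  (- (K * dpart [:: i; i] rho x)) (dpart [:: i; i] u x) q c C.
rewrite /= l0 sqrrN exprMn => H; apply: H => //.
- near=> t; have Olt : O (l t) by near: t.
  have ? := C2_on_is_derive_line C2rho Olt (isT : (size [::] <= 1)%N).
  by apply: is_derive_eq; rewrite /GRing.scale/=; ring.
- have := C2_on_is_derive_line C2rho Ol0 (isT : (size [:: i] <= 1)%N).
  rewrite -/(l 0) l0 => ?.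
  by apply: is_derive_eq; rewrite /GRing.scale/=; ring.
- near=> t; have Olt : O (l t) by near: t.
  exact: (C2_on_is_derive_line C2u Olt (isT : (size [::] <= 1)%N)).
- have := C2_on_is_derive_line C2u Ol0 (isT : (size [:: i] <= 1)%N).
  by rewrite -/(l 0) l0.
- exact: near_l fmax.
Unshelve. all: by end_near. Qed.

(** * Comparison on the domain and nonexistence *)

Lemma continuous_bounded_above (R : realType) (T : topologicalType) (f : T -> R)
    (A : set T) :
  compact A -> {within A, continuous f} -> exists B, 0 < B /\ forall x, A x -> f x <= B.
Proof.
move=> cA cf; have [->|/set0P A0] := eqVneq A set0; first by exists 1.
have [z _ fz] := compact_EVT_max A0 cA cf.
exists (Num.max (f z) 1); split; first by rewrite lt_max ltr01 orbT.
by move=> x Ax; rewrite le_max fz// inE.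
Qed.

Theorem theorem3p1 (R : realType) (N : nat) (Omega : set 'rV[R]_N)
    (g p : R -> R) (C : R) :
  (2 <= N)%N ->
  bounded_domain Omega -> smooth_boundary Omega ->
  (* g in C^1(0,oo), positive, decreasing, g(0+) = +oo *)
  (forall t, 0 < t -> derivable g t 1 /\ {for t, continuous (derive1 g)}) ->
  (forall t, 0 < t -> 0 < g t) ->
  (forall s t, 0 < s -> s < t -> g t < g s) ->
  g x @[x --> 0^'+] --> +oo ->
  (* p : (0,oo) -> (0,oo), nonincreasing, (locally) Hoelder continuous *)
  (forall t, 0 < t -> 0 < p t) ->
  (forall s t, 0 < s -> s <= t -> p t <= p s) ->
  loc_holder_pos p ->
  (\int[(@lebesgue_measure R)]_(t in `]0%R, 1%R]%classic) (t * p t)%:E = +oo)%E ->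
  ~ exists u : 'rV[R]_N -> R,
      C2_on Omega u /\ {within closure Omega, continuous u} /\
      (forall x, Omega x ->
         - laplacian u x + C * grad_norm2 u x >= p (dist_bdry Omega x) * g (u x)) /\
      (forall x, Omega x -> 0 < u x) /\
      (forall x, bdry Omega x -> u x = 0).
Proof.
move=> N2 [ Omega_neq0 [oOmega [_ [M OmegaM]]]] [rho [srho [OmegaE rho_reg]]].
move=> _ g0 g_decr _ p0 p_ninc p_holder p_int [u [C2u [uc [u_ineq [u0 _]]]]].
have N0 : (0 < N)%N by exact: leq_trans N2.
subst Omega.
have p_cont (t : R) : 0 < t -> {for t, continuous p}.
  exact: loc_holder_pos_continuous.
have OmegaM' x : rho x < 0 -> enorm x <= M by exact: OmegaM.
have clc : compact (closure [set x | rho x < 0]).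
  apply: (compact_closed_subset OmegaM') => //; exact: closed_closure.
have bounded_on_closure (f : 'rV[R]_N -> R) : continuous f ->
    exists B, 0 < B /\ forall x, rho x < 0 -> f x <= B.
  move=> fc; have [|B [B0 fB]] := @continuous_bounded_above _ _ f _ clc.
    exact: continuous_subspaceT.
  by exists B; split=> // x rx; apply: fB; exact: subset_closure.
have dpart_cont l : continuous (dpart l rho) by have [] := srho l.
have [U [U0 uU]] := continuous_bounded_above clc uc.
have [K [K0 dK]] := dist_bdry_le_level srho rho_reg Omega_neq0 OmegaM' N0.
have [S [S0 rhoS]] : exists S, 0 < S /\ forall x, rho x < 0 -> - rho x <= S.
  apply: (bounded_on_closure (fun x => - rho x)) => x.
  by apply: (@cvgN _ _ _ (nbhs x)); exact: (dpart_cont [::]).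
have [B1 [B10 gradB]] : exists B, 0 < B /\ forall x, rho x < 0 ->
    grad_norm2 rho x <= B.
  apply: bounded_on_closure; apply: continuous_big => [|i _ x].
    exact: add_continuous.
  by apply: (@cvgM _ _ (nbhs x)); exact: dpart_cont.
have [B2 [B20 lapB]] : exists B, 0 < B /\ forall x, rho x < 0 ->
    laplacian rho x <= B.
  apply: bounded_on_closure; apply: continuous_big => [|i _].
    exact: add_continuous.
  exact: dpart_cont.
pose D := Num.max C 1; have D0 : 0 < D by rewrite lt_max ltr01 orbT.
have u_ineqD x : rho x < 0 ->
    p (dist_bdry [set x | rho x < 0] x) * g (u x) <=
    - (laplacian u x - D * grad_norm2 u x).
  move=> rx; apply: le_trans (u_ineq x rx) _; rewrite opprB addrC lerD2r.
  by rewrite ler_wpM2r ?le_max ?lexx// sumr_ge0// => i _; exact: sqr_ge0.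
(* The 1 puts [a] strictly above every value of [- (K * rho x)] on the domain. *)
pose a := K * S + 1.
have gU : 0 < g U by exact: g0.
(* [A * p d] is a lower bound for the Laplacian of [expR (- (D * u))]. The constant [c] is such that
   [c * A] exceeds by 1 the total of the gradient and first-order terms of the barrier. *)
pose A := D * expR (- (D * U)) * g U.
have A0 : 0 < A by rewrite !mulr_gt0 ?expR_gt0.
pose c := (K ^+ 2 * B1 + a * (K * B2) + 1) / A.
have a0 : 0 < a by rewrite addr_gt0 ?mulr_gt0.
have c0 : 0 < c by rewrite divr_gt0// !addr_gt0 ?mulr_gt0 ?exprn_gt0.
have [x0 rx0] := Omega_neq0.
have level0 x : rho x < 0 -> 0 < - (K * rho x) by move=> rx; rewrite oppr_gt0 pmulr_rlt0.
have levela x : rho x < 0 -> - (K * rho x) < a.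
  move=> rx; rewrite /a -mulrN ltr_pwDr// ler_wpM2l ?(ltW K0)//; exact: rhoS.
have [e [Psi [psi [e0 ex0 Psie Psix0 dPsi]]]] :=
  barrier_exists (c + 1) p_cont p0 p_ninc p_int (level0 x0 rx0) (levela x0 rx0).
(* Up to the constant [c], this is [Psi s - c * (1 - expR (- (D * u)))]. It is maximised over [E], a
   compact subset of the domain. *)
pose f x := Psi (- (K * rho x)) + c * expR (- (D * u x)).
pose E := [set x | e <= - (K * rho x)].
have EO x : E x -> rho x < 0.
  by rewrite /E/= => /(lt_le_trans e0); rewrite oppr_gt0 pmulr_rlt0.
have level_cont : continuous (fun x => - (K * rho x)).
  move=> x; apply: (@cvgN _ _ _ (nbhs x)); apply: (@cvgM _ _ (nbhs x)); first exact: cvg_cst.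
  exact: (dpart_cont [::]).
have cE : compact E.
  apply: (compact_closed_subset OmegaM'); last first.
    by move=> x Ex; apply: subset_closure; exact: EO.
  apply: (@closed_comp _ _ (fun x => - (K * rho x)) [set r | e <= r]); last exact: closed_ge.
  by move=> x _; exact: level_cont.
have fc : {within E, continuous f}.
  apply: continuous_in_subspaceT => x; rewrite inE => Ex.
  have rx := EO _ Ex.
  have [|dP _ _ _] := dPsi (- (K * rho x)); first by rewrite Ex ltW ?levela.
  apply: (@cvgD _ _ _ (nbhs x)).
    apply: (@cvg_comp _ _ _ (fun x => - (K * rho x)) Psi _ (nbhs (- (K * rho x)))).
      exact: level_cont.
    by case: dP => /derivable1_diffP/differentiable_continuous.
  apply: (@cvgM _ _ (nbhs x)); first exact: cvg_cst.
  apply: (@cvg_comp _ _ _ (fun x => - (D * u x)) expR _ (nbhs (- (D * u x)))).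
    apply: (@cvgN _ _ _ (nbhs x)); apply: (@cvgM _ _ (nbhs x)); first exact: cvg_cst.
    by have [/(_ [::] isT)] := C2u x rx.
  exact: continuous_expR.
have Ex0 : E x0 by exact: ltW.
have [x Ex fmax] := compact_EVT_max (ex_intro _ x0 Ex0) cE fc.
rewrite inE in Ex; have rx := EO _ Ex.
have fx0 : c < f x.
  apply: lt_le_trans (fmax x0 _); last by rewrite inE.
  rewrite /f; apply: (@lt_le_trans _ _ (c + 1)); first by rewrite ltrDl.
  by apply: le_trans Psix0 _; rewrite lerDl mulr_ge0 ?expR_ge0// ltW.
(* Where the level is [e], [Psi] vanishes and the exponential is at most 1, so [f <= c]. Since
   [f x0 >= c + 1], the maximum lies off that level and is a local maximum of [f]. *)
have ex : e < - (K * rho x).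
  rewrite lt_neqAle [X in _ && X]Ex andbT; apply/eqP => eE.
  move: fx0; rewrite /f -eE Psie add0r ltNge => /negP; apply.
  rewrite -[leRHS]mulr1 ler_wpM2l ?(ltW c0)// -expR0 ler_expR oppr_le0.
  by rewrite mulr_ge0 ?ltW// u0.
have near_fmax : \forall y \near x, f y <= f x.
  have : \forall y \near x, e < - (K * rho y).
    by apply: (@cvgr_gt _ _ (nbhs x) _ _ (- (K * rho x))) => //; exact: level_cont.
  by apply: filterS => y ey; apply: fmax; rewrite inE; exact: ltW.
have near_dPsi : \forall r \near - (K * rho x), is_derive (r : R) 1 Psi (psi r).
  near=> r; have [|//] := dPsi r; apply/andP; split; apply: ltW; near: r.
    exact: lt_nbhsr.
  by apply: lt_nbhsl; exact: levela.
have [|_ dpsi psi0 psia] := dPsi (- (K * rho x)).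
  by rewrite ltW ?ltW ?levela.
have := laplacian_at_max oOmega rx (smooth_C2_on srho) C2u near_dPsi dpsi near_fmax.
(* It remains to show that the same expression is positive. *)
apply/negP; rewrite -ltNge.
set r := - (K * rho x) in psi0 psia *.
have pr0 : 0 < p r by apply: p0; exact: level0.
have d0 : 0 < dist_bdry [set x | rho x < 0] x.
  by apply: dist_bdry_gt0 => //; exact: (bdry_sublevel_neq0 srho rho_reg Omega_neq0 OmegaM' N0).
have pd : p r <= p (dist_bdry [set x | rho x < 0] x).
  by apply: p_ninc => //; rewrite /r -mulrN; exact: dK.
have uxU : u x <= U by apply: uU; exact: subset_closure.
have gx : g U <= g (u x).
  (* [g] is strictly decreasing as a hypothesis, so equality is split off. *)
  have [->//|uxU'] := eqVneq (u x) U.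
  by apply/ltW/g_decr; [exact: u0|rewrite lt_neqAle uxU'].
have H1 : p r * g U <= - (laplacian u x - D * grad_norm2 u x).
  by apply: le_trans (u_ineqD x rx); rewrite ler_pM// ltW.
have H2 : A * p r <= D * expR (- (D * u x)) * - (laplacian u x - D * grad_norm2 u x).
  rewrite /A -mulrA -[g U * _]mulrC.
  apply: ler_pM => //; [by rewrite mulr_ge0 ?expR_ge0 ?ltW|by rewrite mulr_ge0 ?ltW|].
  by rewrite ler_wpM2l ?(ltW D0)// ler_expR lerN2 ler_wpM2l ?(ltW D0).
have H3 : psi r * (K * laplacian rho x) <= a * p r * (K * B2).
  apply: (@le_trans _ _ (psi r * (K * B2))).
    by rewrite ler_wpM2l// ler_wpM2l ?(ltW K0)// lapB.
  by rewrite ler_wpM2r// mulr_ge0 ?ltW.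
have H4 : p r * (K ^+ 2 * grad_norm2 rho x) <= p r * (K ^+ 2 * B1).
  by rewrite ler_wpM2l ?(ltW pr0)// ler_wpM2l ?exprn_ge0 ?(ltW K0)// gradB.
have H5 : c * (A * p r) = (K ^+ 2 * B1 + a * (K * B2) + 1) * p r.
  have <- : c * A = K ^+ 2 * B1 + a * (K * B2) + 1 by rewrite /c divfK// gt_eqF.
  by rewrite mulrA.
(* The term in [u] contributes at least [c * A * p r]; after [H3] and [H4] a surplus of at least
   [p r] remains, and it is positive. *)
have := ler_wpM2l (ltW c0) H2; rewrite H5.
move: H3 H4 pr0; clear.
by lra.
Unshelve. all: by end_near. Qed.
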